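(* Let $k\ge 2$, let $\lambda$ be an almost self-conjugate partition of rank $d$, and let $\mu=(k^d1^e)$ be a partition with $|\mu|=|\lambda|$. Write the Frobenius coordinates of $\lambda$ as $(f_1,\ldots,f_d\mid f_1-1,\ldots,f_d-1)$ and set $f_{d+1}=0$. Then $\mathrm{SRHT}(\lambda,\mu)$ is nonempty if and only if (1) $f_j+f_{d+1-j}\ge k$ for $1\le j\le d$, and (2) $f_{j+1}+f_{d+1-j}<k$ for $1\le j\le d$.
   Context: For a partition $\lambda$, $\lambda'$ is its conjugate, and its rank is the largest $i$ with $\lambda_i\ge i$. If the rank is $r$, the Frobenius coordinates of $\lambda$ are $(\lambda_1-1,\ldots,\lambda_r-r\mid\lambda'_1-1,\ldots,\lambda'_r-r)$. $\lambda$ is almost self-conjugate (ASC) if $\lambda_i=\lambda'_i+1$ for $1\le i\le$ rank$(\lambda)$. $(k^d1^e)$ is the partition with $d$ parts equal to $k$ and $e$ parts equal to $1$. A ribbon is a connected skew shape containing no $2\times 2$ square of cells (the empty ribbon is allowed); an $m$-ribbon has $m$ cells; its sign is $(-1)^{(\text{number of rows it occupies})-1}$. A rim-hook tableau of shape $\lambda$ and content $\alpha=(\alpha_1,\ldots,\alpha_\ell)$ is a chain of partitions $\emptyset=\nu^0\subseteq\nu^1\subseteq\cdots\subseteq\nu^\ell=\lambda$ with each $\nu^i/\nu^{i-1}$ an $\alpha_i$-ribbon. For partitions $\lambda,\mu$ of the same size, a special rim-hook tableau of shape $\lambda$ and type $\mu$ is a rim-hook tableau of shape $\lambda$ whose content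 sorted into weakly decreasing order equals $\mu$ and each of whose nonempty ribbons contains a cell in the first column of the Young diagram of $\lambda$; $\mathrm{SRHT}(\lambda,\mu)$ is the set of these. *)

(* Defs.v *)
From mathcomp Require Import all_boot.

Set Implicit Arguments.
Unset Strict Implicit.
Unset Printing Implicit Defensive.

Definition is_part (s : seq nat) : bool := sorted geq s && all (leq 1) s.

(* Parts, rows and columns are numbered from 1; parts beyond the last are 0. *)
Definition part (s : seq nat) (i : nat) : nat := nth 0 s i.-1.

Definition conj_part (s : seq nat) : seq nat :=
  [seq count (leq j) s | j <- iota 1 (part s 1)].

(* The largest i >= 1 with s_i >= i, or 0 if there is none. *)
Definition rank (s : seq nat) : nat :=
  \max_(1 <= i < (size s).+1 | i <= part s i) i.

(* Subtraction does not truncate: s_i >= i and s'_i >= i for i <= rank s. *)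
Definition frobenius (s : seq nat) : seq nat * seq nat :=
  ([seq part s i - i | i <- iota 1 (rank s)],
   [seq part (conj_part s) i - i | i <- iota 1 (rank s)]).

Definition almost_self_conjugate (s : seq nat) : Prop :=
  forall i, 1 <= i <= rank s -> part s i = part (conj_part s) i + 1.

Definition cells (s : seq nat) : seq (nat * nat) :=
  [seq (i, j) | i <- iota 1 (size s), j <- iota 1 (part s i)].

Definition skew (nu rho : seq nat) : seq (nat * nat) :=
  [seq c <- cells nu | c \notin cells rho].

Definition adjacent (c c' : nat * nat) : bool :=
  (c.1 == c'.1) && ((c.2.+1 == c'.2) || (c'.2.+1 == c.2)) ||
  (c.2 == c'.2) && ((c.1.+1 == c'.1) || (c'.1.+1 == c.1)).

Definition connected (C : seq (nat * nat)) : Prop :=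
  forall x y, x \in C -> y \in C ->
  exists p, [/\ path adjacent x p, {subset p <= C} & last x p = y].

Definition no_square (C : seq (nat * nat)) : Prop :=
  forall i j,
  ~ [/\ (i, j) \in C, (i, j.+1) \in C, (i.+1, j) \in C & (i.+1, j.+1) \in C].

Definition ribbon (m : nat) (nu rho : seq nat) : Prop :=
  [/\ {subset cells rho <= cells nu}, connected (skew nu rho),
      no_square (skew nu rho) & size (skew nu rho) = m].

(* T lists nu^0, ..., nu^l and al lists al_1, ..., al_l, so that with 0-based
   indexing al_i is the size of T_(i+1) / T_i. *)
Definition rim_hook_tableau (la al : seq nat) (T : seq (seq nat)) : Prop :=
  [/\ size T = (size al).+1,
      all is_part T,
      nth [::] T 0 = [::],
      nth [::] T (size al) = la
    & forall i, i < size al ->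
        ribbon (nth 0 al i) (nth [::] T i.+1) (nth [::] T i)].

(* Zero entries of the content (empty ribbons) are dropped before comparing with
   mu, since a partition is listed here without trailing zeros. *)
Definition SRHT (la mu : seq nat) (T : seq (seq nat)) : Prop :=
  exists al : seq nat,
  [/\ rim_hook_tableau la al T,
      sort geq [seq a <- al | 0 < a] = mu
    & forall i, i < size al ->
        let C := skew (nth [::] T i.+1) (nth [::] T i) in
        C <> [::] -> exists r, (r, 1) \in C].

(* Main.v *)
Require Import Defs.
From mathcomp Require Import all_boot zify.

(** Removing from [nu], of length [l], a ribbon that meets the first column
    means choosing a row [i], deleting [nu_i - i + l] cells, and shifting the
    rows below [i] one step up and to the left.  Hence special rim-hook tableaux
    of shape [la] amount to permutations [s] of [{1, ..., l}] with all
    [la_i - i + s_i >= 0], these numbers being the ribbon sizes.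

    For [la] almost self-conjugate of rank [d], [l = f_1] and the numbers
    [la_i - i] are [f_1, ..., f_d] together with [- m] for the [m] in
    [{1, ..., l}] that are not some [f_j].  With ribbon sizes in [{0, 1, k}] and
    [d] of them equal to [k], the first [d] rows must get [s_j = k - f_j] and a
    row [- m] must get [m] or [m + 1].  Such an [s] exists iff the sets
    [{k - f_j}] and [{f_j}] interlace, which is what (1) and (2) say. *)

Set Implicit Arguments.
Unset Strict Implicit.
Unset Printing Implicit Defensive.

(** * Partitions and skew shapes by row lengths *)

Lemma part_nth_geq s i j : is_part s -> i <= j -> nth 0 s j <= nth 0 s i.
Proof.
move=> /andP[ss _] leij; case: (ltnP j (size s)) => [ltj|lej]; last first.
  by rewrite nth_default.
have tr : transitive geq by move=> y x z; rewrite /geq /=; lia.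
have rf : reflexive geq by move=> x; rewrite /geq /=.
by apply: (sorted_leq_nth tr rf 0 ss) => //; rewrite inE; lia.
Qed.

Lemma part_nth_gt0 s i : is_part s -> (0 < nth 0 s i) = (i < size s).
Proof.
move=> /andP[_ ps]; case: (ltnP i (size s)) => [lti|lei]; last by rewrite nth_default.
by apply: (allP ps); rewrite mem_nth.
Qed.

Lemma part_eq_nth s t : is_part s -> is_part t -> nth 0 s =1 nth 0 t -> s = t.
Proof.
move=> ps pt E; apply: (@eq_from_nth _ 0) => [|i _]; last exact: E.
have := part_nth_gt0 (size s) ps; have := part_nth_gt0 (size t) ps.
have := part_nth_gt0 (size s) pt; have := part_nth_gt0 (size t) pt.
by rewrite !E; lia.
Qed.

Lemma mem_cells s i j : ((i, j) \in cells s) = [&& 0 < i, 0 < j & j <= part s i].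
Proof.
apply/allpairsPdep/idP => [[x [y []]]|].
  by rewrite !mem_iota => ? ? [-> ->]; lia.
case/and3P=> i0 j0 jle; exists i, j; split=> //; rewrite mem_iota; last by lia.
case: (ltnP i (1 + size s)) => [|le]; first by lia.
by move: jle; rewrite /part nth_default; lia.
Qed.

Lemma mem_cellsS s i j : ((i.+1, j.+1) \in cells s) = (j < nth 0 s i).
Proof. by rewrite mem_cells. Qed.

Lemma uniq_cells s : uniq (cells s).
Proof.
apply: allpairs_uniq_dep => [|i _|]; try exact: iota_uniq.
by move=> [a b] [c e] /= _ _ [-> ->].
Qed.

Lemma size_cells s : size (cells s) = sumn s.
Proof.
rewrite size_allpairs_dep; congr sumn; apply: (@eq_from_nth _ 0).
  by rewrite size_map size_iota.
move=> i; rewrite size_map size_iota => lti.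
by rewrite (nth_map 0) ?size_iota // nth_iota.
Qed.

Lemma mem_skew nu rho i j :
  ((i.+1, j.+1) \in skew nu rho) = (nth 0 rho i <= j < nth 0 nu i).
Proof. by rewrite mem_filter !mem_cellsS -leqNgt. Qed.

Lemma skewP nu rho x :
  reflect (exists i j, x = (i.+1, j.+1) /\ nth 0 rho i <= j < nth 0 nu i)
    (x \in skew nu rho).
Proof.
apply: (iffP idP) => [|[i [j [-> h]]]]; last by rewrite mem_skew.
case: x => [[|i] [|j]] h; last by exists i, j; rewrite -mem_skew.
all: by move: h; rewrite mem_filter !mem_cells /= ?andbF.
Qed.

Lemma cells_subP nu rho :
  {subset cells rho <= cells nu} <-> (forall i, nth 0 rho i <= nth 0 nu i).
Proof.
split=> [sub i|le [[|i] [|j]]]; try by rewrite !mem_cells /= ?andbF.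
- case E: (nth 0 rho i) => [//|m]; rewrite -E.
  by have := sub (i.+1, m.+1); rewrite !mem_cellsS E => /(_ (ltnSn _)).
- by rewrite !mem_cellsS => h; apply: leq_trans h (le i).
Qed.

Lemma size_skew nu rho :
  {subset cells rho <= cells nu} -> size (skew nu rho) + sumn rho = sumn nu.
Proof.
move=> sub; rewrite -!size_cells /skew size_filter.
rewrite -(count_predC (mem (cells rho)) (cells nu)) addnC; congr (_ + _).
rewrite -size_filter; apply/perm_size/uniq_perm; rewrite ?filter_uniq ?uniq_cells //.
by move=> x; rewrite mem_filter inE; apply/idP/andP => [h|[]//]; split=> //; apply: sub.
Qed.

(** * Ribbons that meet the first column *)

(** For partitions and [i < size nu], this strips the rim from row [i], counted from 0, down to the
    last row. The number of cells lost is the hook length of the first cell of row [i]. *)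
Definition hook_removed (i : nat) (nu rho : seq nat) : Prop :=
  forall p, nth 0 rho p = if p < i then nth 0 nu p else (nth 0 nu p.+1).-1.

Lemma sumn_nth s n : size s <= n -> sumn s = \sum_(0 <= p < n) nth 0 s p.
Proof.
move=> le; rewrite sumnE (big_nth 0) (big_cat_nat (leq0n _) le) /=.
rewrite [X in _ = _ + X]big_nat_cond [X in _ = _ + X]big1 ?addn0 // => p.
by rewrite andbT => /andP[h _]; rewrite nth_default.
Qed.

Lemma hook_removed_size_le i nu rho :
  is_part rho -> i < size nu -> hook_removed i nu rho -> size rho < size nu.
Proof.
move=> prho lti h; have := part_nth_gt0 (size nu).-1 prho.
rewrite h; have -> : ((size nu).-1 < i) = false by lia.
by rewrite nth_default; lia.
Qed.

Lemma sumn_hook_removed i nu rho :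
  is_part nu -> is_part rho -> i < size nu -> hook_removed i nu rho ->
  sumn rho + (nth 0 nu i + size nu - i.+1) = sumn nu.
Proof.
move=> pnu prho lti h; have lts := hook_removed_size_le prho lti h.
(* Row [p >= i] of [rho] is row [p.+1] of [nu] less one cell, so [n] rows of [rho] are compared with
   [n.+1] rows of [nu]; row [i] and one cell per shifted row make up the difference. *)
have tel n : i <= n < size nu ->
    (\sum_(0 <= p < n) nth 0 rho p) + (nth 0 nu i + (n - i)) =
    \sum_(0 <= p < n.+1) nth 0 nu p.
  elim: n => [|n IH] b.
    have -> : i = 0 by lia.
    by rewrite big_geq // big_nat1; lia.
  case: (ltnP n i) => [ltn|len]; last first.
    rewrite big_nat_recr //= [RHS]big_nat_recr //= -IH; last by lia.
    rewrite h; have -> : (n < i) = false by lia.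
    by have := part_nth_gt0 n.+1 pnu; lia.
  have -> : i = n.+1 by lia.
  rewrite [RHS]big_nat_recr //= subnn addn0; congr (_ + _).
  by apply: eq_big_nat => p bp; rewrite h ifT //; lia.
rewrite (@sumn_nth rho (size nu).-1); last by lia.
rewrite (@sumn_nth nu (size nu).-1.+1); last by lia.
by rewrite -tel; lia.
Qed.

(** Adjacent cells differ by at most one in row, so the first step of the path that leaves the rows
    below [P] is vertical. *)
Lemma path_crosses_row (C : seq (nat * nat)) P x p :
  path adjacent x p -> x \in C -> {subset p <= C} -> P < x.1 -> (last x p).1 <= P ->
  exists c, (P, c) \in C /\ (P.+1, c) \in C.
Proof.
elim: p x => [|y p IH] x /=; first by lia.
case/andP=> adj pth xC sub Px lastP.
have yC : y \in C by apply: sub; rewrite mem_head.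
case: (ltnP P y.1) => [Py|yP].
  by apply: (IH y) => // z zp; apply: sub; rewrite inE zp orbT.
exists y.2; case: x y {IH pth sub lastP} adj xC yC Px yP => [a b] [c e] /=.
rewrite /adjacent /= => adj xC yC Px yP.
have [E1 [E2 E3]] : c = P /\ a = P.+1 /\ b = e by lia.
by subst.
Qed.

(* Connectedness makes consecutive rows of the skew shape overlap, and the
   absence of 2x2 squares bounds the overlap by one column. *)
Lemma ribbon_hook_removed m nu rho r :
  is_part nu -> is_part rho -> ribbon m nu rho -> (r, 1) \in skew nu rho ->
  exists2 i, i < size nu & hook_removed i nu rho.
Proof.
move=> pnu prho [/cells_subP sub conn nosq _] rD.
have [r' [j [[Er Ej] hr]]] := skewP _ _ _ rD; subst r j.
set l := size nu.
have l0 : r' < l by rewrite -part_nth_gt0 //; lia.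
have ex : exists i, nth 0 rho i < nth 0 nu i by exists r'; lia.
(* The row sought is the topmost one in which the two shapes differ. *)
case: (ex_minnP ex) => i hi mini.
have il : i < l by rewrite -part_nth_gt0 //; lia.
exists i => // p; case: ltnP => [ltp|lep].
  have := sub p; case: (ltnP (nth 0 rho p) (nth 0 nu p)) => [/mini|]; lia.
case: (ltnP p.+1 l) => [ltp|lp]; last first.
  have -> : nth 0 nu p.+1 = 0 by rewrite nth_default.
  by have := @part_nth_geq rho r' p prho; lia.
have lastD : ((l.-1).+1, 0.+1) \in skew nu rho.
  rewrite mem_skew (part_nth_gt0 _ pnu).
  by have := @part_nth_geq rho r' l.-1 prho; rewrite -/l; lia.
have topD : (i.+1, (nth 0 rho i).+1) \in skew nu rho by rewrite mem_skew; lia.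
(* A path from the foot of the ribbon to its top crosses between rows [p.+1] and [p], counted from
   0, within one column; hence [nth 0 rho p < nth 0 nu p.+1]. *)
have [q [qp qs ql]] := conn _ _ lastD topD.
have [||c [cD1 cD2]] := @path_crosses_row _ p.+1 _ _ qp lastD qs.
- by rewrite /=; lia.
- by rewrite ql.
have /skewP[x [c' [[Ex Ec]] h1]] := cD1; subst x c.
move: cD2; rewrite mem_skew => h2.
case: (leqP (nth 0 nu p.+1) (nth 0 rho p).+1) => [|big]; first by lia.
case: (nosq p.+1 (nth 0 rho p).+1).
have := @part_nth_geq rho p p.+1 prho; have := @part_nth_geq nu p p.+1 pnu.
by rewrite !mem_skew; split; lia.
Qed.

Definition joined (C : seq (nat * nat)) (x y : nat * nat) : Prop :=
  exists p, [/\ path adjacent x p, {subset p <= C} & last x p = y].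

Lemma joined_trans C y x z : joined C x y -> joined C y z -> joined C x z.
Proof.
move=> [p [pp ps pl]] [q [qp qs ql]]; exists (p ++ q); split.
- by rewrite cat_path pp pl.
- by move=> u; rewrite mem_cat => /orP[/ps|/qs].
- by rewrite last_cat pl.
Qed.

Lemma adjacentC x y : adjacent x y = adjacent y x.
Proof. by rewrite /adjacent; lia. Qed.

Lemma joined_step C x y : adjacent x y -> y \in C -> joined C x y.
Proof.
move=> a yC; exists [:: y]; split => //=; first by rewrite a.
by move=> z; rewrite inE => /eqP->.
Qed.

Lemma joined_sym C x y : x \in C -> joined C x y -> joined C y x.
Proof.
move=> xC [p [pp ps <-]] {y}; elim: p x xC pp ps => [|z p IH] x xC /=.
  by exists [::].
case/andP=> a pp ps.
apply: (@joined_trans _ z); last by apply: joined_step; rewrite // adjacentC.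
by apply: IH => //; [apply: ps; rewrite mem_head | move=> u up; apply: ps; rewrite inE up orbT].
Qed.

(** Walking left along a row, and down from its leftmost removed cell, leads from every removed cell
    to the foot of the first column. Consecutive rows share at most one column, so there is no
    square. *)
Lemma hook_removed_ribbon i nu rho :
  is_part nu -> is_part rho -> i < size nu -> hook_removed i nu rho ->
  ribbon (nth 0 nu i + size nu - i.+1) nu rho /\ (size nu, 1) \in skew nu rho.
Proof.
move=> pnu prho lti h; have lts := hook_removed_size_le prho lti h.
have sub : {subset cells rho <= cells nu}.
  apply/cells_subP => p; rewrite h; case: ifP => // _.
  by have := @part_nth_geq nu p p.+1 pnu; lia.
have lastD : (size nu, 1) \in skew nu rho.
  have -> : (size nu, 1) = ((size nu).-1.+1, 0.+1) by congr (_, _); lia.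
  have := part_nth_gt0 (size nu).-1 pnu.
  by rewrite mem_skew (nth_default 0 (s := rho)); lia.
split=> //; split => //.
- have base x : x \in skew nu rho -> joined (skew nu rho) x (size nu, 1).
    have [n] := ubnP (x.2 + (size nu - x.1)); elim: n x => // n IH x ltn xD.
    have [a [b [E hab]]] := skewP _ _ _ xD; subst x; move: ltn => /= ltn.
    have al : a < size nu by rewrite -part_nth_gt0 //; lia.
    case: (ltnP (nth 0 rho a) b) => [ltb|leb].
      have yD : (a.+1, b.-1.+1) \in skew nu rho by rewrite mem_skew; lia.
      apply: (joined_trans (y := (a.+1, b.-1.+1))).
        by apply: joined_step => //; rewrite /adjacent /=; lia.
      by apply: IH => //=; lia.
    have Eb : b = nth 0 rho a by lia.
    have ai : i <= a.
      by rewrite leqNgt; apply/negP => lt; have := h a; rewrite lt; lia.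
    have Ea := h a; rewrite ltnNge ai /= in Ea.
    case: (ltnP a.+1 (size nu)) => [lta|lea].
      have pos := part_nth_gt0 a.+1 pnu.
      have lt : nth 0 rho a.+1 < nth 0 nu a.+1.
        rewrite h ifN; last by lia.
        by have := @part_nth_geq nu a.+1 a.+2 pnu; lia.
      have yD : (a.+2, b.+1) \in skew nu rho by rewrite mem_skew; lia.
      apply: (joined_trans (y := (a.+2, b.+1))).
        by apply: joined_step => //; rewrite /adjacent /=; lia.
      by apply: IH => //=; lia.
    have Ez : nth 0 nu a.+1 = 0 by rewrite nth_default.
    have -> : (a.+1, b.+1) = (size nu, 1) by congr (_, _); lia.
    by exists [::].
  move=> x y xD yD; apply: joined_trans (base x xD) _.
  exact: joined_sym (base y yD).
- move=> a b [] /skewP[a' [b' [[-> ->] ]]].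
  by rewrite !mem_skew h; case: ifP => _; lia.
- by have := size_skew sub; have := sumn_hook_removed pnu prho lti h; lia.
Qed.

Lemma hook_removed_exists i nu : is_part nu ->
  exists2 rho, is_part rho & hook_removed i nu rho.
Proof.
move=> pnu; pose t := mkseq (fun p => if p < i then nth 0 nu p else (nth 0 nu p.+1).-1) (size nu).
have tnth p : nth 0 t p = if p < i then nth 0 nu p else (nth 0 nu p.+1).-1.
  case: (ltnP p (size nu)) => [ltp|lep]; first by rewrite nth_mkseq.
  rewrite !nth_default ?size_mkseq //; first by case: ifP.
  exact: leqW.
have tmono p q : p <= q -> nth 0 t q <= nth 0 t p.
  move=> le; rewrite !tnth; have := @part_nth_geq nu _ _ pnu le.
  have := @part_nth_geq nu p.+1 q.+1 pnu; have := @part_nth_geq nu q q.+1 pnu.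
  by do 2 case: ifP; lia.
have srt : sorted geq t.
  by apply/(sortedP 0) => p _; apply: tmono.
(* The zeros of a weakly decreasing list are at its end, so dropping them changes no value of
   [nth 0]. *)
exists (filter (leq 1) t).
  rewrite /is_part filter_all andbT; apply: sorted_filter srt.
  by move=> y x z; rewrite /geq /=; lia.
move=> p; rewrite -tnth; elim: t srt {tnth tmono} p => [//|x t IH] srt p.
have srt' := path_sorted srt.
have tr : transitive geq by move=> u v w; rewrite /geq /=; lia.
have /allP xmax := order_path_min tr srt.
rewrite /=; case: ifP => x0; first by case: p => //= p; apply: IH.
rewrite IH //; have z q : nth 0 t q = 0.
  case: (ltnP q (size t)) => [lt|le]; last by rewrite nth_default.
  by have := xmax _ (mem_nth 0 lt); rewrite /geq /=; lia.
by rewrite z; case: p => [|p] /=; rewrite ?z; lia.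
Qed.

(** * Row assignments under insertion and deletion of a row *)

(* The entries [v] are the degrees of the nonzero term of the Jacobi-Trudi
   determinant [det (h_(nu_i - i + j))] selected by the permutation [s]. *)
Definition row_assign (n : nat) (nu s v : seq nat) : Prop :=
  [/\ perm_eq s (iota 1 n), size v = n
    & forall p, p < n -> nth 0 nu p + nth 0 s p = p.+1 + nth 0 v p].

Lemma row_assign_size n nu s v : row_assign n nu s v -> size s = n.
Proof. by case=> /perm_size->; rewrite size_iota. Qed.

(** One ribbon can exhaust several rows, so the smaller shape must be padded with empty rows before
    an insertion. An empty row keeps its own number and has value 0. *)
Lemma row_assign_widen n m nu s v :
  size nu <= n -> row_assign n nu s v ->
  row_assign (n + m) nu (s ++ iota n.+1 m) (v ++ nseq m 0).
Proof.
move=> le ra; have szs := row_assign_size ra; case: ra => ps szv h; split.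
- by rewrite iotaD perm_cat2r.
- by rewrite size_cat size_nseq szv.
move=> p ltp; rewrite !nth_cat szs szv; case: ltnP => [|lep]; first exact: h.
rewrite nth_iota ?nth_nseq; last by lia.
by rewrite nth_default; [case: ifP; lia | lia].
Qed.

Lemma nth_insert (s : seq nat) i x p : i <= size s ->
  nth 0 (take i s ++ x :: drop i s) p =
  if p < i then nth 0 s p else if p == i then x else nth 0 s p.-1.
Proof.
move=> le; rewrite nth_cat size_take_min (minn_idPl le).
case: ltnP => lep; first by rewrite nth_take.
case: eqP => [->|ne]; first by rewrite subnn.
have -> : p - i = (p.-1 - i).+1 by lia.
by rewrite /= nth_drop; congr nth; lia.
Qed.

Lemma nth_delete (s : seq nat) i p : i < size s ->
  nth 0 (take i s ++ drop i.+1 s) p = if p < i then nth 0 s p else nth 0 s p.+1.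
Proof.
move=> lt; rewrite nth_cat size_take_min (minn_idPl (ltnW lt)).
case: ltnP => lep; first by rewrite nth_take.
by rewrite nth_drop; congr nth; lia.
Qed.

Lemma perm_delete (s : seq nat) i : i < size s ->
  perm_eq s (nth 0 s i :: (take i s ++ drop i.+1 s)).
Proof.
move=> lt; rewrite -[X in perm_eq X _](cat_take_drop i) (drop_nth 0) //.
by rewrite -cat1s perm_catCA.
Qed.

Lemma perm_insert (s : seq nat) i x : perm_eq (take i s ++ x :: drop i s) (x :: s).
Proof. by rewrite perm_catC /= perm_cons perm_catC cat_take_drop. Qed.

(** From [rho] to [nu], a row at or below [i] moves down by one and grows by one cell. Length minus
    row number is thus unchanged, and so is the value in [v]. The new row [i] takes the largest
    number. *)
Lemma row_assign_insert i nu rho s v :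
  is_part nu -> i < size nu -> hook_removed i nu rho ->
  row_assign (size nu).-1 rho s v ->
  row_assign (size nu) nu (take i s ++ size nu :: drop i s)
    (take i v ++ (nth 0 nu i + size nu - i.+1) :: drop i v).
Proof.
move=> pnu lti hr ra; have szs := row_assign_size ra; case: ra => ps szv h; split.
- rewrite (permPl (perm_insert _ _ _)).
  have -> : iota 1 (size nu) = rcons (iota 1 (size nu).-1) (size nu).
    have {1}-> : size nu = (size nu).-1 + 1 by lia.
    by rewrite iotaD /= -cats1; congr (_ ++ [:: _]); lia.
  by rewrite perm_sym perm_rcons perm_cons perm_sym.
- by rewrite (perm_size (perm_insert _ _ _)) /= szv; lia.
move=> p ltp; rewrite !nth_insert ?szs ?szv; try by lia.
have := part_nth_gt0 p pnu; have := h p; have := h p.-1.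
case: (ltngtP p i) => [lt|gt|->] h1 h2 pos.
- by have := hr p; rewrite lt; lia.
- have := hr p.-1; have -> : p.-1.+1 = p by lia.
  have -> : (p <= i) = false by lia.
  by lia.
- by lia.
Qed.

Lemma row_assign_delete i nu rho s v :
  is_part nu -> hook_removed i nu rho ->
  row_assign (size nu) nu s v -> i < size nu -> nth 0 s i = size nu ->
  row_assign (size nu).-1 rho (take i s ++ drop i.+1 s) (take i v ++ drop i.+1 v).
Proof.
move=> pnu hr ra lti si; have szs := row_assign_size ra; case: ra => ps szv h; split.
- have := perm_delete (i := i) (s := s); rewrite szs si => /(_ lti) hp.
  rewrite -(perm_cons (size nu)) -(permPl hp) (permPl ps).
  have {1}-> : size nu = (size nu).-1 + 1 by lia.
  rewrite iotaD /= perm_catC /=.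
  by have -> : 1 + (size nu).-1 = size nu by lia.
- have := perm_size (perm_delete (i := i) (s := v) _); rewrite szv => /(_ lti) /=.
  by lia.
move=> p ltp; rewrite !nth_delete ?szs ?szv //.
have := part_nth_gt0 p.+1 pnu; have := h p; have := h p.+1; have := hr p.
by case: ltnP; lia.
Qed.

(** * Tableaux and row assignments *)

(** Along the chain, each nonempty ribbon inserts the number of rows of the larger shape at the row
    where the ribbon has its top, with the ribbon size as value. *)
Lemma SRHT_row_assign la mu T : is_part la -> SRHT la mu T ->
  exists s v, row_assign (size la) la s v /\ perm_eq [seq a <- v | 0 < a] mu.
Proof.
move=> pla [al [[szT pT T0 Tl rib] mu_al col1]].
have pTi i : i <= size al -> is_part (nth [::] T i).
  by move=> le; apply: (allP pT); rewrite mem_nth // szT ltnS.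
have main i : i <= size al -> exists s v,
    row_assign (size (nth [::] T i)) (nth [::] T i) s v /\
    perm_eq [seq a <- v | 0 < a] [seq a <- take i al | 0 < a].
  elim: i => [|i IH] le; first by rewrite T0 take0; exists [::], [::].
  have [s [v [ra pv]]] := IH (ltnW le).
  have pnu := pTi _ le; have prho := pTi _ (ltnW le).
  have := rib i le; have := col1 i le; rewrite (take_nth 0) // filter_rcons.
  move: (nth [::] T i.+1) (nth [::] T i) ra pnu prho => nu rho ra pnu prho c1 rb.
  have [sub _ _ szm] := rb.
  case: posnP => [m0|m0].
    suff -> : nu = rho by exists s, v.
    apply: part_eq_nth => // p; apply/eqP; rewrite eqn_leq andbC.
    rewrite (cells_subP _ _).1 //= leqNgt; apply/negP => lt.
    have : (p.+1, (nth 0 rho p).+1) \in skew nu rho by rewrite mem_skew leqnn.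
    by move: szm; rewrite m0 => /size0nil->.
  have [|r rD] := c1 _; first by move=> E; rewrite E in szm; rewrite -szm in m0.
  have [j ltj hr] := ribbon_hook_removed pnu prho rb rD.
  have lts := hook_removed_size_le prho ltj hr.
  have [[_ _ _ szm'] _] := hook_removed_ribbon pnu prho ltj hr.
  have := row_assign_widen ((size nu).-1 - size rho) (leqnn _) ra.
  rewrite subnKC; last by lia.
  move=> /(row_assign_insert pnu ltj hr); set s' := (X in row_assign _ _ X _).
  set v0 := v ++ _; set v' := (X in row_assign _ _ _ X) => ra'.
  exists s', v'; split=> //.
  rewrite (perm_trans (perm_filter _ (perm_insert _ _ _))) //= -szm' szm m0.
  rewrite perm_sym perm_rcons perm_cons perm_sym /v0 filter_cat.
  suff -> : [seq a <- nseq ((size nu).-1 - size rho) 0 | 0 < a] = [::] by rewrite cats0.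
  by elim: (_ - _).
have [s [v [ra pv]]] := main _ (leqnn _); exists s, v; rewrite -Tl; split=> //.
by rewrite (perm_trans pv) // take_size -mu_al perm_sym perm_sort.
Qed.

(** The induction removes the outermost ribbon. The bound is [size nu <= n] because the remaining
    shape may have fewer than [n] rows; an empty last row yields no ribbon. *)
Lemma row_assign_tableau n nu s v :
  is_part nu -> size nu <= n -> row_assign n nu s v ->
  exists al T, [/\ rim_hook_tableau nu al T,
    perm_eq [seq a <- al | 0 < a] [seq a <- v | 0 < a]
    & forall i, i < size al -> exists r,
        (r, 1) \in skew (nth [::] T i.+1) (nth [::] T i)].
Proof.
elim: n nu s v => [|n IH] nu s v pnu le ra.
  have nu0 : nu = [::] by apply: size0nil; lia.
  have v0 : v = [::] by case: ra => _ /size0nil.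
  by exists [::], [:: [::]]; rewrite nu0 v0; split.
have szs := row_assign_size ra.
case: (ltnP (size nu) n.+1) => [lt|ge].
  (* The empty last row forces [s] to fix [n.+1]. *)
  have [ps szv h] := ra.
  have sn : nth 0 s n = n.+1 /\ nth 0 v n = 0.
    have := h n (ltnSn n); rewrite (nth_default 0 (s := nu)); last by lia.
    have : nth 0 s n \in iota 1 n.+1 by rewrite -(perm_mem ps) mem_nth ?szs.
    by rewrite mem_iota; lia.
  have [sn1 vn] := sn.
  have dn (t : seq nat) : size t = n.+1 -> t = rcons (take n t) (nth 0 t n).
    by move=> sz; rewrite -take_nth ?sz // take_oversize ?sz.
  have ra' : row_assign n nu (take n s) (take n v).
    split; last by move=> p ltp; rewrite !nth_take //; apply: h; lia.
    - move: ps; rewrite {1}(dn s szs) sn1 -addn1 iotaD /= cats1 add1n addn1.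
      by rewrite perm_rcons perm_sym perm_rcons perm_cons perm_sym.
    - by rewrite size_take szv ltnSn.
  have [al [T [ht pv c1]]] := IH nu _ _ pnu lt ra'.
  exists al, T; split=> //; rewrite (dn v szv) vn filter_rcons /=.
  exact: pv.
have En : n.+1 = size nu by lia.
(* The row that holds the largest number is the top row of the last ribbon. *)
rewrite En in ra szs; set i := index (size nu) s.
have si : nth 0 s i = size nu.
  by rewrite nth_index //; case: ra => /perm_mem-> _ _; rewrite mem_iota; lia.
have lti : i < size nu.
  by rewrite -szs index_mem; case: ra => /perm_mem-> _ _; rewrite mem_iota; lia.
have [rho prho hr] := hook_removed_exists i pnu.
have lts := hook_removed_size_le prho lti hr.
have ra' := row_assign_delete pnu hr ra lti si.
rewrite -En /= in ra'.
have [|al [T [[szT pT T0 Tl rib] pv c1]]] := IH _ _ _ prho _ ra'; first by lia.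
have [rb cD] := hook_removed_ribbon pnu prho lti hr.
set m := nth 0 nu i + _ - _ in rb.
have [_ szv hv] := ra.
have vi : nth 0 v i = m by have := hv i lti; rewrite /m si; lia.
have m0 : 0 < m by have := part_nth_gt0 i pnu; rewrite /m; lia.
exists (rcons al m), (rcons T nu).
have nT j : j <= size al -> nth [::] (rcons T nu) j = nth [::] T j.
  by move=> lej; rewrite nth_rcons szT ltnS lej.
have nTl : nth [::] (rcons T nu) (size al).+1 = nu.
  by rewrite nth_rcons szT ltnn eqxx.
split.
- split; rewrite ?size_rcons ?szT // ?nT //; first by rewrite all_rcons pnu.
  move=> j; rewrite ltnS leq_eqVlt => /orP[/eqP->|ltj].
    by rewrite nTl nT // Tl nth_rcons ltnn eqxx.
  by rewrite !nT ?(ltnW ltj) // nth_rcons ltj; apply: rib.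
- have := perm_filter (leq 1) (perm_delete (i := i) (s := v) _); rewrite szv => /(_ lti).
  rewrite /= vi m0 => hp; rewrite filter_rcons m0 perm_rcons perm_sym.
  by rewrite (perm_trans hp) // perm_cons perm_sym.
- move=> j; rewrite size_rcons ltnS leq_eqVlt => /orP[/eqP->|ltj].
    by rewrite nTl nT // Tl; exists (size nu).
  by rewrite !nT ?(ltnW ltj) //; apply: c1.
Qed.

Lemma geq_sorted_perm_eq (s t : seq nat) :
  sorted geq s -> sorted geq t -> perm_eq s t -> s = t.
Proof.
apply: sorted_eq; first by move=> y x z; rewrite /geq /=; lia.
by move=> x y; rewrite /geq /=; lia.
Qed.

Lemma row_assign_SRHT la mu s v :
  is_part la -> sorted geq mu -> row_assign (size la) la s v ->
  perm_eq [seq a <- v | 0 < a] mu -> exists T, SRHT la mu T.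
Proof.
move=> pla smu ra pv; have [al [T [ht pal c1]]] := row_assign_tableau pla (leqnn _) ra.
exists T, al; split=> //; last by move=> i lti C _; apply: c1.
apply: geq_sorted_perm_eq => //.
  by apply: sort_sorted => x y; rewrite /geq /=; lia.
by rewrite perm_sort (perm_trans pal).
Qed.

(** * Counting and complementary sets *)

Lemma count_iota_ge (a : pred nat) x y d :
  (forall p, x <= p < y -> a p) -> y <= d -> y - x <= count a (iota 0 d).
Proof.
move=> h le; rewrite -size_filter -{1}(size_iota x (y - x)).
apply: uniq_leq_size; first exact: iota_uniq.
by move=> p; rewrite mem_filter !mem_iota => b; rewrite h; lia.
Qed.

Lemma count_iota_le (a : pred nat) x y d :
  (forall p, p < d -> a p -> x <= p < y) -> count a (iota 0 d) <= y - x.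
Proof.
move=> h; rewrite -size_filter -(size_iota x (y - x)).
apply: uniq_leq_size; first by rewrite filter_uniq // iota_uniq.
by move=> p; rewrite mem_filter !mem_iota => /andP[ap b]; have := h p _ ap; lia.
Qed.

Lemma count_leq_iota t l : t <= l -> count (leq^~ t) (iota 1 l) = t.
Proof.
move=> le; rewrite -(subnKC le) iotaD count_cat.
have -> : count (leq^~ t) (iota 1 t) = t.
  rewrite -[RHS](size_iota 1 t); apply/eqP; rewrite -all_count; apply/allP => x.
  by rewrite mem_iota; lia.
rewrite (eq_in_count (a2 := pred0)) ?count_pred0 ?addn0 // => x.
by rewrite mem_iota /=; lia.
Qed.

Lemma leq_count_in (a b : pred nat) s :
  {in s, forall x, a x -> b x} -> count a s <= count b s.
Proof.
move=> h; rewrite (@eq_in_count _ _ (predI a b)); first by apply: sub_count => x /andP[].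
by move=> x xs /=; case ax: (a x) => //=; rewrite (h x).
Qed.

Lemma perm_iota_inj l (g : nat -> nat) :
  (forall p, p < l -> 1 <= g p <= l) ->
  (forall p q, p < q < l -> g p <> g q) ->
  perm_eq (map g (iota 0 l)) (iota 1 l).
Proof.
move=> rg inj; have un : uniq (map g (iota 0 l)).
  rewrite map_inj_in_uniq ?iota_uniq // => p q; rewrite !mem_iota => bp bq E.
  case: (ltngtP p q) => // lt; first by case: (inj p q) => //; lia.
  by case: (inj q p) => //; lia.
have [] := uniq_min_size un (s2 := iota 1 l).
- by move=> x /mapP[p]; rewrite !mem_iota => bp ->; have := rg p; lia.
- by rewrite size_map !size_iota.
by move=> _ E; apply: uniq_perm => //; apply: iota_uniq.
Qed.

(* [f_1 > ... > f_d] and [m_d < ... < m_(l-1)] enumerate complementary subsets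
   of [{1, ..., l}]. *)
Definition complementary (d l : nat) (f m : nat -> nat) : Prop :=
  [/\ forall p, p < d -> 1 <= f p.+1 <= l,
      forall p q, p < q < d -> f q.+1 < f p.+1,
      forall p, d <= p < l -> 1 <= m p <= l,
      forall p q, d <= p < q -> q < l -> m p < m q
    & forall p q, p < d -> d <= q < l -> f p.+1 <> m q].

Lemma complementary_count d l f m t :
  d <= l -> complementary d l f m -> t <= l ->
  count (fun p => f p.+1 <= t) (iota 0 d) +
  count (fun p => m p <= t) (iota d (l - d)) = t.
Proof.
move=> dl [fr fd mr mi dj] tl.
pose u p := if p < d then f p.+1 else m p.
have pu : perm_eq (map u (iota 0 l)) (iota 1 l).
  apply: perm_iota_inj => [p ltp|p q b]; rewrite /u.
    by case: (ltnP p d) => h; [apply: fr | apply: mr; lia].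
  case: (ltnP p d) => hp; case: (ltnP q d) => hq.
  - by have := fd p q; lia.
  - by apply: dj; lia.
  - by lia.
  - by have := mi p q; lia.
rewrite -[RHS](count_leq_iota tl) -(permP pu) -{2}(subnKC dl) iotaD map_cat count_cat.
rewrite !count_map; congr (_ + _); apply: eq_in_count => p; rewrite mem_iota /u /=.
  by move=> ->.
by move=> b; rewrite ifN //; lia.
Qed.

(** * Shifts and the interlacing conditions *)

(** Both [g] and the pair [f], [m] exhaust [1, ..., l]. As [g] is [m] or [m + 1] on the late rows,
    comparing counts up to [t] shows that the [k - f_j] up to [t] are at least as many as the [f_j]
    up to [t] ([c1]), and those up to [t + 1] exceed the latter by at most one ([c2]). *)
Lemma complementary_shift_necessary k d l f m g :
  d <= l -> complementary d l f m -> perm_eq (map g (iota 0 l)) (iota 1 l) ->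
  (forall p, p < d -> f p.+1 + g p = k) ->
  (forall p, d <= p < l -> m p <= g p <= (m p).+1) ->
  f (d + 1) = 0 ->
  (forall j, 1 <= j <= d -> k <= f j + f (d + 1 - j)) /\
  (forall j, 1 <= j <= d -> f (j + 1) + f (d + 1 - j) < k).
Proof.
move=> dl cmp pg gf gm f0; have [fr fd mr mi dj] := cmp.
have cg t : t <= l -> count (fun p => g p <= t) (iota 0 d) +
    count (fun p => g p <= t) (iota d (l - d)) = t.
  move=> tl; rewrite -[RHS](count_leq_iota tl) -(permP pg) -{2}(subnKC dl) iotaD.
  by rewrite map_cat count_cat !count_map.
have fd' p q : p <= q < d -> f q.+1 <= f p.+1.
  by case: (ltngtP p q) => [lt|//|->] // b; apply: ltnW; apply: fd; lia.
have c1 t : t <= l -> count (fun p => f p.+1 <= t) (iota 0 d) <=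
    count (fun p => g p <= t) (iota 0 d).
  move=> tl; have := cg t tl; have := complementary_count dl cmp tl.
  suff : count (fun p => g p <= t) (iota d (l - d)) <=
         count (fun p => m p <= t) (iota d (l - d)) by lia.
  by apply: leq_count_in => p; rewrite mem_iota => b; have := gm p; lia.
have c2 t : t < l -> count (fun p => g p <= t.+1) (iota 0 d) <=
    (count (fun p => f p.+1 <= t) (iota 0 d)).+1.
  move=> tl; have := cg t.+1 tl; have := complementary_count dl cmp (ltnW tl).
  suff : count (fun p => m p <= t) (iota d (l - d)) <=
         count (fun p => g p <= t.+1) (iota d (l - d)) by lia.
  by apply: leq_count_in => p; rewrite mem_iota => b; have := gm p; lia.
split=> j bj.
  (* If (1) fails at [j], then at [t = f_(d+1-j)] at least [j] of the [f_i] but at most [j - 1] of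
     the [k - f_i] are at most [t], against [c1]. *)
  rewrite leqNgt; apply/negP => lt.
  have E : d + 1 - j = (d - j).+1 by lia.
  rewrite E in lt; have rt := fr (d - j); have := c1 (f (d - j).+1).
  have := @count_iota_ge (fun p => f p.+1 <= f (d - j).+1) (d - j) d d _ (leqnn d).
  have := @count_iota_le (fun p => g p <= f (d - j).+1) 0 j.-1 d.
  have A p : p < d -> g p <= f (d - j).+1 -> 0 <= p < j.-1.
    move=> pd le; have := gf p pd; have := fd' j.-1 p.
    by rewrite prednK; lia.
  have B p : d - j <= p < d -> f p.+1 <= f (d - j).+1 by apply: fd'.
  by move=> /(_ A) ? /(_ B) ?; lia.
(* For [j = d] the claim is [f_1 < k], which holds because [g 0] is positive. *)
case: (ltnP j d) => [ltj|lej]; last first.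
  have -> : j = d by lia.
  rewrite f0; have -> : d + 1 - d = 1 by lia.
  have := gf 0; have : g 0 \in iota 1 l.
    by rewrite -(perm_mem pg); apply: map_f; rewrite mem_iota; lia.
  by rewrite mem_iota; lia.
(* If (2) fails at [j < d], then at least [j + 1] of the [k - f_i] are at most [f_(d+1-j)], while at
   most [j - 1] of the [f_i] lie strictly below it, against [c2]. *)
rewrite ltnNge; apply/negP => ge.
have E : d + 1 - j = (d - j).+1 by lia.
rewrite E addn1 in ge; have rt := fr (d - j); have := c2 (f (d - j).+1).-1.
have := @count_iota_le (fun p => f p.+1 <= (f (d - j).+1).-1) (d - j).+1 d d.
have := @count_iota_ge (fun p => g p <= f (d - j).+1) 0 j.+1 d.
have A p : 0 <= p < j.+1 -> g p <= f (d - j).+1.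
  by move=> b; have := gf p; have := gf j ltj; have := fd' p j; lia.
have B p : p < d -> f p.+1 <= (f (d - j).+1).-1 -> (d - j).+1 <= p < d.
  by move=> pd le; have := fd' p (d - j); lia.
move=> /(_ A ltj) ? /(_ B) ?; rewrite prednK; last by lia.
by lia.
Qed.

(* The row of [m] is shifted exactly when [m] lies in some interval
   [[k - f_j, f_(d+1-j))]; conditions (1) and (2) make these disjoint. *)
Lemma complementary_shift_sufficient k d l f m :
  complementary d l f m -> f (d + 1) = 0 ->
  (forall j, 1 <= j <= d -> k <= f j + f (d + 1 - j)) ->
  (forall j, 1 <= j <= d -> f (j + 1) + f (d + 1 - j) < k) ->
  exists c : nat -> bool,
    (forall p, p < d -> f p.+1 <= k) /\
    perm_eq [seq if p < d then k - f p.+1 else m p + c p | p <- iota 0 l] (iota 1 l).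
Proof.
move=> [fr fd mr mi dj] f0 H1 H2.
have fd' p q : p <= q < d -> f q.+1 <= f p.+1.
  by case: (ltngtP p q) => [lt|//|->] // b; apply: ltnW; apply: fd; lia.
have fk p : p < d -> f p.+1 < k.
  move=> pd; have := H2 d; rewrite f0 addKn; have := fd' 0 p.
  by lia.
have h1 j : j < d -> k <= f j.+1 + f (d - j).
  by move=> jd; have := H1 j.+1; rewrite addn1 subSS; apply; lia.
have h2 j q : j < q < d -> f q.+1 + f (d - j) < k.
  move=> b; have := H2 j.+1; rewrite addn1 addn1 subSS.
  by have := fd' j.+1 q; lia.
have fdj j : j < d -> f (d - j) = f (d - j).-1.+1 by move=> jd; rewrite prednK; lia.
pose c p := has (fun j => (k <= f j.+1 + m p) && (m p < f (d - j))) (iota 0 d).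
have cT p : c p -> exists2 j, j < d & (k <= f j.+1 + m p) && (m p < f (d - j)).
  by case/hasP=> j; rewrite mem_iota => b h; exists j.
have cF p j : c p = false -> j < d -> k <= f j.+1 + m p -> f (d - j) <= m p.
  move=> /negbT/hasPn h jd le; have := h j; rewrite mem_iota /= => /(_ jd).
  by rewrite le /= -leqNgt.
exists c; split=> [p pd|]; first by have := fk p pd; lia.
(* A shifted [m q] lies in the interval of some [j]: [k - f p.+1] is at most its left end if
   [p <= j] and beyond its right end if [p > j]. An unshifted collision would force
   [m q = f (d - p)]. *)
have mixed p q : p < d -> d <= q < l -> k - f p.+1 <> m q + c q.
  move=> pd b E; have kp := fk p pd; case cq: (c q) E => E.
    have [j jd /andP[a1 a2]] := cT q cq.
    case: (leqP p j) => pj; first by have := fd' p j; lia.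
    by have := h2 j p; lia.
  have := cF q p cq pd; have := h1 p pd; have := dj (d - p).-1 q.
  by rewrite -fdj //; lia.
apply: perm_iota_inj => [p ltp|p q b].
  case: (ltnP p d) => pd.
    have := fk p pd; have := h1 p pd; have := fr (d - p).-1; rewrite -fdj //.
    by lia.
  have := mr p; case cp: (c p); last by lia.
  have [j jd /andP[a1 a2]] := cT p cp.
  by have := fr (d - j).-1; rewrite -fdj //; lia.
case: (ltnP p d) => pd; case: (ltnP q d) => qd.
- by have := fd p q; have := fk p pd; have := fk q qd; lia.
- by apply: mixed; lia.
- by lia.
(* Only a shifted [m p] and an unshifted [m q = m p + 1] could collide; then [m q] would be the
   right end [f (d - j)] of the interval, which is not a value of [m]. *)
have lt := mi p q; case cp: (c p); case cq: (c q); try by lia.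
have [j jd /andP[a1 a2]] := cT p cp; have := cF q j cq jd.
by have := dj (d - j).-1 q; rewrite -fdj //; lia.
Qed.

(** * Conjugate, rank and Frobenius coordinates *)

Lemma count_leq_part s i j : is_part s -> (i < count (leq j.+1) s) = (j < nth 0 s i).
Proof.
elim: s i => [|x s IH] i ps; first by rewrite nth_nil.
have ps' : is_part s.
  by move: ps => /andP[/path_sorted ? /andP[_ ?]]; apply/andP.
have mono := @part_nth_geq _ 0 _ ps (leq0n _).
rewrite /=; case: (ltnP j x) => jx.
  by case: i => [|i] /=; rewrite ?add1n ?ltnS ?IH //; lia.
rewrite add0n IH //; have := mono i.+1; have := mono i => /=; lia.
Qed.

Lemma part_conj_part s j : is_part s -> part (conj_part s) j.+1 = count (leq j.+1) s.
Proof.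
move=> ps; rewrite /part /conj_part /=; case: (ltnP j (part s 1)) => lt.
  by rewrite (nth_map 0) ?size_iota // nth_iota.
rewrite nth_default ?size_map ?size_iota //; apply/eqP.
by rewrite eq_sym -leqn0 leqNgt count_leq_part // -leqNgt.
Qed.

Lemma leq_rank s i : i < nth 0 s i -> i < rank s.
Proof.
move=> lt; have lts : i < size s.
  by rewrite ltnNge; apply/negP => le; rewrite nth_default in lt.
apply: (@leq_bigmax_seq _ (index_iota 1 (size s).+1) (fun j => j <= part s j) id i.+1) => //.
by rewrite mem_index_iota; lia.
Qed.

Lemma rank_leq_nth s p : is_part s -> p < rank s -> rank s <= nth 0 s p.
Proof.
move=> ps lt; have rk : rank s <= part s (rank s).
  by rewrite {2}/rank /rank; elim/big_ind: _ => // x y hx hy; rewrite /maxn; case: ifP.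
by apply: leq_trans rk _; apply: part_nth_geq => //; lia.
Qed.

(** The third conclusion keeps the subtraction [p.+1 - nth 0 la p] in the fourth from truncating on
    the rows past the rank. *)
Lemma asc_complementary la d f :
  is_part la -> almost_self_conjugate la -> rank la = d ->
  (frobenius la).1 = [seq f j | j <- iota 1 d] ->
  [/\ d <= size la, forall p, p < d -> nth 0 la p = f p.+1 + p.+1,
      forall p, d <= p -> nth 0 la p <= p
    & complementary d (size la) f (fun p => p.+1 - nth 0 la p)].
Proof.
move=> pla asc rk; rewrite /frobenius /= rk => frob.
have lad p : p < d -> d <= nth 0 la p by rewrite -rk; apply: rank_leq_nth.
have laf p : p < d -> nth 0 la p = f p.+1 + p.+1.
  move=> pd; have := congr1 (nth 0 ^~ p) frob.
  rewrite !(nth_map 0) ?size_iota // !nth_iota // /part add1n /= => E.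
  by have := lad p pd; lia.
have ldl p : d <= p -> nth 0 la p <= p.
  by move=> le; rewrite leqNgt; apply/negP => /leq_rank; rewrite rk; lia.
have dl : d <= size la.
  case: d lad {rk frob laf ldl} => // d' lad; have := part_nth_gt0 d' pla.
  by have := lad d' (ltnSn _); lia.
(* Almost self-conjugacy gives column [p.+1] the length [f p.+1 + p]; this bounds [f] and separates
   it from [m]. *)
have cnt p : p < d -> f p.+1 + p = count (leq p.+1) la.
  move=> pd; have := asc p.+1; rewrite rk part_conj_part // /part /= laf //.
  by lia.
split=> //; split.
- move=> p pd; have := cnt p pd; have := count_size (leq p.+1) la.
  have := count_leq_part p p pla; have := lad p pd.
  by lia.
- move=> p q b; have := @part_nth_geq la p q pla; rewrite !laf; lia.
- by move=> p b; have := ldl p; lia.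
- by move=> p q b ql; have := @part_nth_geq la p q pla; have := ldl p; lia.
(* If [f_(p+1) = q+1 - la_q], then [la_i - i + la'_j - j + 1 = 0] at the cell
   [(i, j) = (q+1, p+1)]; but this number is positive inside the diagram of [la]
   and negative outside. *)
- move=> p q pd b E; have := cnt p pd; have := count_leq_part q p pla.
  have := ldl q; lia.
Qed.

(** * Total size and the equivalence *)

(** On summing over the rows, the permutation [s] cancels against the row numbers. *)
Lemma row_assign_sumn n nu s v :
  size nu <= n -> row_assign n nu s v -> sumn v = sumn nu.
Proof.
move=> le ra; have szs := row_assign_size ra; have [ps szv h] := ra.
have Es : sumn s = \sum_(0 <= p < n) p.+1.
  rewrite (perm_sumn ps) sumnE -[1]addn0 iotaDl big_map.
  by rewrite /index_iota subn0; apply: eq_bigr => i _; rewrite add1n.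
have : sumn nu + sumn s = sumn s + sumn v.
  rewrite {2}Es (sumn_nth le) (@sumn_nth s n) ?szs // (@sumn_nth v n) ?szv //.
  by rewrite -!big_split /=; apply: eq_big_nat => p b; apply: h.
lia.
Qed.

Lemma filter_nat_of_bool (bs : seq bool) :
  [seq a <- map nat_of_bool bs | 0 < a] = nseq (sumn (map nat_of_bool bs)) 1.
Proof. by elim: bs => [|[] bs IH] //=; rewrite IH. Qed.

Lemma hook_type_sorted k d e : 0 < k -> sorted geq (nseq d k ++ nseq e 1).
Proof.
move=> k0; elim: d => [|[|d] IH] /=.
- by elim: e => [|[|e]] //= ->; rewrite /geq /= leqnn.
- by case: e IH => [|e] //= ->; rewrite /geq /= k0.
- by rewrite /= in IH; rewrite IH /geq /= leqnn.
Qed.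

Theorem theorem4p14 (k d e : nat) (la mu : seq nat) (f : nat -> nat) :
  2 <= k ->
  is_part la ->
  almost_self_conjugate la ->
  rank la = d ->
  mu = nseq d k ++ nseq e 1 ->
  sumn mu = sumn la ->
  frobenius la = ([seq f j | j <- iota 1 d], [seq f j - 1 | j <- iota 1 d]) ->
  f (d + 1) = 0 ->
  (exists T : seq (seq nat), SRHT la mu T) <->
  (forall j, 1 <= j <= d -> k <= f j + f (d + 1 - j)) /\
  (forall j, 1 <= j <= d -> f (j + 1) + f (d + 1 - j) < k).
Proof.
move=> k2 pla asc rk Emu Esum frob f0.
have [|dl laf ldl cmp] := @asc_complementary la d f pla asc rk; first by rewrite frob.
have [fr _ _ _ _] := cmp.
split=> [[T /(SRHT_row_assign pla) [s [v [ra pv]]]]|[H1 H2]].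
  have szs := row_assign_size ra; have [ps szv h] := ra.
  have vals p : p < size la -> nth 0 v p \in [:: 0; 1; k].
    move=> pl; case: (posnP (nth 0 v p)) => [->|v0]; first by rewrite inE.
    have : nth 0 v p \in [seq a <- v | 0 < a] by rewrite mem_filter v0 mem_nth ?szv.
    by rewrite (perm_mem pv) Emu mem_cat !mem_nseq !inE; lia.
  (* Here [v_p] is [f p.+1] plus the entry of [s], both positive, so it is at least 2 and must be
     [k]. *)
  have vk p : p < d -> nth 0 v p = k.
    move=> pd; have := vals p; have := h p; have := fr p pd; rewrite laf //.
    have : nth 0 s p \in iota 1 (size la) by rewrite -(perm_mem ps) mem_nth ?szs; lia.
    by rewrite mem_iota !inE; lia.
  (* The type has exactly [d] parts [k], all taken by the first [d] rows. *)
  have tailk : count_mem k (drop d v) = 0.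
    have : count_mem k v = d.
      have := permP pv (pred1 k); rewrite count_filter Emu count_cat !count_nseq /= eqxx.
      rewrite mul1n; have -> : (1 == k) = false by lia.
      rewrite addn0 => <-; apply: eq_count => x /=; lia.
    rewrite -{1}(cat_take_drop d v) count_cat.
    have -> : take d v = nseq d k.
      apply: (@eq_from_nth _ 0); rewrite size_takel ?size_nseq ?szv //.
      by move=> p pd; rewrite nth_take // nth_nseq pd vk.
    by rewrite count_nseq /= eqxx; lia.
  have v01 p : d <= p < size la -> nth 0 v p <= 1.
    move=> b; have := vals p; suff : nth 0 v p <> k by rewrite !inE; lia.
    move=> E; have : k \in drop d v.
      rewrite -E; have -> : p = d + (p - d) by lia.
      by rewrite -nth_drop mem_nth // size_drop szv; lia.
    by rewrite -has_pred1 has_count tailk.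
  apply: (complementary_shift_necessary dl cmp (g := nth 0 s)) => //.
  - by rewrite map_nth_iota0 ?szs // take_oversize ?szs.
  - by move=> p pd; have := h p; rewrite vk // laf //; lia.
  - by move=> p b; have := h p; have := v01 p b; have := ldl p; lia.
have [c [fk pg]] := complementary_shift_sufficient cmp f0 H1 H2.
pose v := nseq d k ++ map nat_of_bool (map c (iota d (size la - d))).
have szv : size v = size la by rewrite size_cat size_nseq !size_map size_iota subnKC.
set s := map _ _ in pg.
have ra : row_assign (size la) la s v.
  split=> // p pl; rewrite /s (nth_map 0) ?size_iota // nth_iota // add0n.
  rewrite nth_cat size_nseq; case: ltnP => pd.
    by rewrite nth_nseq pd laf //; have := fk p pd; lia.
  rewrite -map_comp (nth_map 0) ?size_iota; last by lia.
  rewrite nth_iota; last by lia.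
  by rewrite subnKC //=; have := ldl p pd; lia.
apply: (row_assign_SRHT pla _ ra); rewrite Emu; first by apply: hook_type_sorted; lia.
rewrite filter_cat filter_nat_of_bool.
(* Equality of total sizes forces the number of shifted rows to be [e]. *)
have := row_assign_sumn (leqnn _) ra; rewrite -Esum Emu !sumn_cat => /addnI ->.
rewrite sumn_nseq mul1n.
suff -> : [seq a <- nseq d k | 0 < a] = nseq d k by [].
by apply/all_filterP/allP => x; rewrite mem_nseq; lia.
Qed.
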